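(* Let $G$ be a Polish groupoid, $X$ a Polish $G$-space, and $x\in X$ with orbit $[x]$. The following are equivalent: (1) $[x]$ is a $G_\delta$ subset of $X$; (2) $[x]$, with the subspace topology, is a Baire space; (3) $[x]$ is nonmeager in itself.
   Context: A groupoid is a small category in which every arrow is invertible; $G^0$ objects, $s,r$ source and range. A topological space is locally Polish if it has a countable basis of open sets Polish in the relative topology. A Polish groupoid is a groupoid with a locally Polish topology such that composition and inversion are continuous and open, $G^0$ is Polish, and $s^{-1}(x)$, $r^{-1}(x)$ are Polish for all $x\in G^0$. A Polish $G$-space is a Polish space $X$ with a continuous anchor $p:X\to G^0$ and a continuous map $(\gamma,x)\mapsto\gamma x$ on $\{(\gamma,x):s(\gamma)=p(x)\}$ with $\gamma(\rho x)=(\gamma\rho)x$, $p(\gamma x)=r(\gamma)$, $p(x)x=x$. The orbit of $x$ is $[x]=\{\gamma x:s(\gamma)=p(x)\}$. *)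

(* Defs.v *)
From HB Require Import structures.
From mathcomp Require Import all_boot all_order all_algebra.
From mathcomp Require Import all_classical reals topology borel_hierarchy.

Set Implicit Arguments.
Unset Strict Implicit.
Unset Printing Implicit Defensive.

Import Order.TTheory GRing.Theory Num.Theory.

Local Open Scope classical_set_scope.
Local Open Scope ring_scope.

(** For [A : set T], the coercion of [A] to a type carries the relative
    topology, so [polish R A], [baire_space A], etc. speak of the subspace [A]
    (not of the library's [subspace A], whose carrier is all of [T]). *)

Record complete_metric (R : realType) (T : topologicalType) (d : T -> T -> R)
    : Prop := CompleteMetric {
  cm_refl : forall x, d x x = 0 ;
  cm_sep : forall x y, d x y = 0 -> x = y ;
  cm_sym : forall x y, d x y = d y x ;
  cm_triangle : forall x y z, d x z <= d x y + d y z ;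
  cm_nbhs : forall x (A : set T),
    nbhs x A <-> exists2 e : R, 0 < e & [set y | d x y < e] `<=` A ;
  cm_complete : forall u : nat -> T,
    (forall e : R, 0 < e ->
       exists N, forall m n, (N <= m)%N -> (N <= n)%N -> d (u m) (u n) < e) ->
    exists l : T, u @ \oo --> l
}.

Definition separable (T : topologicalType) : Prop :=
  exists2 D : set T, countable D & dense D.

Definition polish (R : realType) (T : topologicalType) : Prop :=
  separable T /\ exists d : T -> T -> R, complete_metric d.

Definition locally_polish (R : realType) (T : topologicalType) : Prop :=
  exists B : set (set T),
    [/\ countable B, basis B & forall U, B U -> polish R U].

Definition baire_space (T : topologicalType) : Prop :=
  forall F : nat -> set T,
    (forall i, open (F i) /\ dense (F i)) -> dense (\bigcap_i F i).

Definition nowhere_dense (T : topologicalType) (A : set T) : Prop :=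
  interior (closure A) = set0.

Definition meager (T : topologicalType) (A : set T) : Prop :=
  exists2 F : nat -> set T, forall i, nowhere_dense (F i) & A = \bigcup_i F i.

Definition nonmeager_in_itself (T : topologicalType) : Prop :=
  ~ meager [set: T].

(** [mul G g h] is the composite "g after h".  It is a total function, but
    everything below only refers to its values on pairs with
    [src g = rng h]; the other values are irrelevant. *)
Record groupoid (Ob Ar : Type) := Groupoid {
  src : Ar -> Ob ;
  rng : Ar -> Ob ;
  idt : Ob -> Ar ;
  mul : Ar -> Ar -> Ar ;
  inv : Ar -> Ar ;
  src_idt : forall a, src (idt a) = a ;
  rng_idt : forall a, rng (idt a) = a ;
  src_mul : forall g h, src g = rng h -> src (mul g h) = src h ;
  rng_mul : forall g h, src g = rng h -> rng (mul g h) = rng g ;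
  mul_assoc : forall g h k, src g = rng h -> src h = rng k ->
    mul g (mul h k) = mul (mul g h) k ;
  mul_idt : forall g, mul g (idt (src g)) = g ;
  idt_mul : forall g, mul (idt (rng g)) g = g ;
  src_inv : forall g, src (inv g) = rng g ;
  rng_inv : forall g, rng (inv g) = src g ;
  mul_inv : forall g, mul g (inv g) = idt (rng g) ;
  inv_mul : forall g, mul (inv g) g = idt (src g)
}.

Definition composable (Ob Ar : Type) (G : groupoid Ob Ar) : set (Ar * Ar) :=
  [set gh | src G gh.1 = rng G gh.2].

(** [pg_idt] expresses the usual identification of the object space with the
    subspace of identity arrows. *)
Record polish_groupoid (R : realType) (Ob Ar : topologicalType)
    (G : groupoid Ob Ar) : Prop := PolishGroupoid {
  pg_idt : forall U : set Ob,
    open U <-> exists2 V : set Ar, open V & U = idt G @^-1` V ;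
  pg_locally_polish : locally_polish R Ar ;
  pg_mul_continuous :
    {within composable G, continuous (fun gh : Ar * Ar => mul G gh.1 gh.2)} ;
  pg_mul_open : forall U : set (Ar * Ar), open U ->
    open [set mul G gh.1 gh.2 | gh in composable G `&` U] ;
  pg_inv_continuous : continuous (inv G) ;
  pg_inv_open : forall U : set Ar, open U -> open [set inv G g | g in U] ;
  pg_ob_polish : polish R Ob ;
  pg_src_fiber_polish : forall a : Ob, polish R [set g | src G g = a] ;
  pg_rng_fiber_polish : forall a : Ob, polish R [set g | rng G g = a]
}.

(** As for [mul], only the values [act g x] with [src G g = p x] matter. *)
Record polish_gspace (R : realType) (Ob Ar : topologicalType)
    (G : groupoid Ob Ar) (X : topologicalType)
    (p : X -> Ob) (act : Ar -> X -> X) : Prop := PolishGSpace {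
  gs_polish : polish R X ;
  gs_anchor_continuous : continuous p ;
  gs_act_continuous :
    {within [set gx : Ar * X | src G gx.1 = p gx.2],
      continuous (fun gx : Ar * X => act gx.1 gx.2)} ;
  gs_anchor_act : forall g x, src G g = p x -> p (act g x) = rng G g ;
  gs_act_mul : forall g h x, src G g = rng G h -> src G h = p x ->
    act g (act h x) = act (mul G g h) x ;
  gs_act_idt : forall x, act (idt G (p x)) x = x
}.

Definition groupoid_orbit (Ob Ar : Type) (G : groupoid Ob Ar) (X : Type)
    (p : X -> Ob) (act : Ar -> X -> X) (x : X) : set X :=
  [set act g x | g in [set g | src G g = p x]].

(* Main.v *)
Require Import Defs.
From mathcomp Require Import all_boot all_order all_algebra.
From mathcomp Require Import all_classical reals topology borel_hierarchy.
From mathcomp Require Import lra.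

(* A [Gdelta] subset of a Polish space is a Baire space, and a nonempty Baire
   space is nonmeager.  Conversely, let [Y] be the orbit of [x] and let [f] map
   an arrow [g] with source [p x] to [g x]; its domain [T] is Polish.

   - If [Y] is nonmeager, some point of [T] is good: [f] maps its neighborhoods
     to sets whose closure in [Y] is a neighborhood of the image point, since
     the other points are mapped to countably many nowhere dense sets.  The
     source map of [G] is open, because the units of [U^-1 U] are those at the
     points of [src U], so translation by an open set of arrows preserves open
     sets; this spreads goodness to all of [T], i.e. [f] is almost open.
   - As [T] is complete, [f @` U] is then comeager in the interior of its
     closure, and preimages of meager sets of [Y] are meager in [T].  Hence two
     images [f @` U1] and [f @` U2] whose closures share an interior point
     meet, and the argument of Pettis' lemma shows that [f] is open onto [Y].
   - An image [Y] of [T] under a map open onto [Y] is [Gdelta]: with open sets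
     [O i] of trace [f @` B i] on [Y], where [B] is a countable basis of [T],
     [Y] consists of the points [z] of its closure, lying in some [O i], such
     that [z \in O i] implies that [z \in O j] for some [B j] of small diameter
     with closure in [B i]. *)

Set Implicit Arguments.
Unset Strict Implicit.
Unset Printing Implicit Defensive.

(* [inv] below is the one of [groupoid], not the one of [functions]. *)
Import Defs.
Import Order.TTheory GRing.Theory Num.Theory.

Local Open Scope classical_set_scope.
Local Open Scope ring_scope.

(** * Shrinking sets and Baire category in complete metric spaces *)

Section CompleteMetricSpaces.
Context (R : realType) (T : topologicalType) (d : T -> T -> R).
Hypothesis dP : complete_metric d.

Lemma cm_ge0 x y : 0 <= d x y.
Proof.
have := cm_triangle dP x y x.
by rewrite (cm_refl dP) (cm_sym dP y x); lra.
Qed.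

Lemma cm_gt0 x y : x <> y -> 0 < d x y.
Proof.
move=> xy; rewrite lt_neqAle cm_ge0 andbT eq_sym.
by apply/eqP => /(cm_sep dP).
Qed.

Lemma cm_open_ball x e : open [set y | d x y < e].
Proof.
rewrite openE => y /= xye; apply/(cm_nbhs dP).
exists (e - d x y); first by rewrite subr_gt0.
by move=> z /=; have := cm_triangle dP x y z; lra.
Qed.

Lemma exists_invS_lt (e : R) : 0 < e -> exists n, n.+1%:R^-1 < e.
Proof.
move=> e0; exists (Num.truncn e^-1).
by rewrite invf_plt ?posrE ?ltr0n// truncnS_gt.
Qed.

(** The closure condition keeps the limit of a shrinking sequence inside all its terms; the bound on
    distances makes chosen points a Cauchy sequence. *)
Definition shrinks (n : nat) (C B : set T) : Prop :=
  closure C `<=` B /\ forall u v, C u -> C v -> d u v < n.+1%:R^-1.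

Lemma shrinks_sub n C B : shrinks n C B -> C `<=` B.
Proof. by case=> CB _; apply: subset_trans CB; exact: subset_closure. Qed.

(** Allowing every subset of [C] makes it possible to take a basis set inside [C] later. *)
Lemma exists_shrinks n (B : set T) x : open B -> B x ->
  exists C, [/\ open C, C x & forall C', C' `<=` C -> shrinks n C' B].
Proof.
move=> oB Bx.
have /(cm_nbhs dP)[e e0 eB] : nbhs x B by apply: open_nbhs_nbhs.
have : 0 < n.+1%:R^-1 :> R by rewrite invr_gt0 ltr0n.
rewrite /shrinks; move: (n.+1%:R^-1) => q q0.
pose r := Num.min (e / 2) (q / 2).
have r0 : 0 < r by rewrite /r lt_min !divr_gt0.
have re : r <= e / 2 by rewrite /r ge_min lexx.
have rn : r <= q / 2 by rewrite /r ge_min lexx orbT.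
exists [set y | d x y < r]; split; first exact: cm_open_ball.
  by rewrite /= (cm_refl dP).
move=> C' C'C; split=> [y C'y|u v /C'C /= xu /C'C /= xv].
  apply: eB => /=.
  have /C'y[z [/C'C /= xz /= yz]] : nbhs y [set z | d y z < e / 2].
    by apply/(cm_nbhs dP); exists (e / 2) => //; rewrite divr_gt0.
  by have := cm_triangle dP x z y; rewrite (cm_sym dP z y); lra.
by have := cm_triangle dP u x v; rewrite (cm_sym dP u x); lra.
Qed.

Lemma nested_limit (C : nat -> set T) :
  (forall n, C n !=set0) -> (forall n, shrinks n (C n.+1) (C n)) ->
  exists l, (forall n, C n l) /\ forall A, nbhs l A -> exists n, C n `<=` A.
Proof.
move=> C0 CS.
have mono n m : (n <= m)%N -> C m `<=` C n.
  move=> /subnKC <-; elim: (m - n)%N => [|k IH]; first by rewrite addn0.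
  by rewrite addnS; apply: subset_trans IH; exact: shrinks_sub (CS _).
have [u uC] := choice C0.
have [e e0|l ul] := cm_complete dP (u := u).
  (* The index is [N.+1] because stage [N] bounds distances in [C N.+1], not in [C N]. *)
  have [N Ne] := exists_invS_lt e0; exists N.+1 => m n Nm Nn.
  by apply: lt_trans Ne; apply: (CS N).2; [exact: mono (uC m)|exact: mono (uC n)].
have Cl n : C n l.
  apply: (CS n).1 => B /ul[N _ NB].
  exists (u (maxn N n.+1)); split.
    by apply: mono (uC _); exact: leq_maxr.
  by apply: NB; exact: leq_maxl.
exists l; split=> // A /(cm_nbhs dP)[e e0 eA].
have [N Ne] := exists_invS_lt e0; exists N.+1 => y Cy.
by apply: eA => /=; apply: lt_trans Ne; apply: (CS N).2.
Qed.

(* Baire's theorem relative to a set [S]; the point found is only in the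
   closure of [S], unless the [D n] force it into [S]. *)
Lemma baire_relative (S : set T) (D : nat -> set T) (O : set T) :
  (forall n, open (D n)) ->
  (forall n (A : set T), open A -> A `&` S !=set0 ->
     A `&` D n `&` S !=set0) ->
  open O -> O `&` S !=set0 ->
  exists z, O z /\ forall n, D n z.
Proof.
move=> oD dD oO OS.
pose P (A : set T) := open A /\ A `&` S !=set0.
have step (nA : nat * set T) : exists C : set T, P nA.2 ->
    P C /\ shrinks nA.1 C (nA.2 `&` D nA.1).
  case: nA => n A /=.
  have [PA|] := pselect (P A); last by move=> nP; exists set0.
  have [y [ADy Sy]] := dD n A PA.1 PA.2.
  have [C [oC Cy CS]] :=
    exists_shrinks n (openI PA.1 (oD n)) ADy.
  by exists C => _; split; [split=> //; exists y|exact: CS].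
have [next nextP] := choice step.
pose C := fix C n := if n is m.+1 then next (m, C m) else O.
have PC n : P (C n).
  by elim: n => [//|n IH]; have [] := nextP (n, C n) IH.
have SC n : shrinks n (C n.+1) (C n `&` D n) := (nextP (n, C n) (PC n)).2.
have [n|n|l [Cl _]] := nested_limit (C := C).
- by have [y [Cy _]] := (PC n).2; exists y.
- by case: (SC n) => CD dC; split=> // y /CD[].
- exists l; split; first exact: (Cl 0%N).
  by move=> n; have [] := shrinks_sub (SC n) (Cl n.+1).
Qed.

(** A closed set is the intersection of its open neighborhoods of radius [n.+1%:R^-1]. An
    implication between membership in two open sets defines a set of this kind. *)
Lemma closed_union_open_Gdelta (C O : set T) :
  closed C -> open O -> Gdelta (C `|` O).
Proof.
move=> cC oO.
exists (fun n => [set z | exists2 c, C c & d c z < n.+1%:R^-1] `|` O).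
  move=> n; apply: openU => //.
  rewrite (_ : [set _ | _] = \bigcup_(c in C) [set z | d c z < n.+1%:R^-1]) //.
  by apply: bigcup_open => c _; exact: cm_open_ball.
apply/seteqP; split=> z.
  move=> [Cz|Oz] n _; last by right.
  by left; exists z => //; rewrite (cm_refl dP) invr_gt0 ltr0n.
move=> Iz; have [Oz|nOz] := pselect (O z); first by right.
left; apply: cC => B /(cm_nbhs dP)[e e0 eB].
have [N Ne] := exists_invS_lt e0.
have [[c Cc cz]|//] := Iz N I.
exists c; split=> //; apply: eB => /=.
by rewrite (cm_sym dP); exact: lt_trans Ne.
Qed.

Lemma closed_Gdelta (C : set T) : closed C -> Gdelta C.
Proof.
by move=> cC; have := closed_union_open_Gdelta cC open0; rewrite setU0.
Qed.

End CompleteMetricSpaces.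

(** * [Gdelta] sets, countable bases, subspaces and Baire spaces *)

Lemma Gdelta_bigcap (T : topologicalType) (A : nat -> set T) :
  (forall n, Gdelta (A n)) -> Gdelta (\bigcap_n A n).
Proof.
move=> GA.
have /choice[F FA] n : exists F : nat -> set T,
    (forall i, open (F i)) /\ A n = \bigcap_i F i.
  by have [F oF AF] := GA n; exists F.
(* Pairs of indices are coded by numbers; a number that codes no pair contributes the whole
   space. *)
exists (fun k => if unpickle k is Some ni then F ni.1 ni.2 else setT).
  by move=> k; case: unpickle => [ni|]; [exact: (FA _).1|exact: openT].
apply/seteqP; split=> z Az.
  move=> k _; case: unpickle => [[n i]|] //=.
  by have := Az n I; rewrite (FA n).2; exact.
move=> n _; rewrite (FA n).2 => i _.
by have := Az (pickle (n, i)) I; rewrite pickleK.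
Qed.

Lemma GdeltaI (T : topologicalType) (A B : set T) :
  Gdelta A -> Gdelta B -> Gdelta (A `&` B).
Proof.
move=> [F oF ->] [H oH ->]; exists (fun n => F n `&` H n).
  by move=> n; exact: openI.
by rewrite bigcapI.
Qed.

Definition sequential_basis (T : topologicalType) (B : nat -> set T) : Prop :=
  (forall i, open (B i)) /\
  forall t (U : set T), open U -> U t -> exists2 i, B i t & B i `<=` U.

Lemma polish_basis (R : realType) (T : topologicalType) : polish R T ->
  exists (d : T -> T -> R) (B : nat -> set T),
    complete_metric d /\ sequential_basis B.
Proof.
move=> [[D /countable_injP[f fD] dD] [d dP]]; exists d.
(* The number [a] names the center through the injection [f], so [B0 a m] is a single ball or
   empty. *)
pose B0 a m := [set t | exists2 c, D c & f c = a /\ d c t < m.+1%:R^-1].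
pose B k := if unpickle k is Some am then B0 am.1 am.2 else set0.
have oB0 a m : open (B0 a m).
  rewrite openE => t [c Dc [fc ct]].
  apply: filterS (open_nbhs_nbhs (conj (cm_open_ball dP c m.+1%:R^-1) ct)).
  by move=> y /= cy; exists c.
exists B; split=> //; split.
  by move=> i; rewrite /B; case: unpickle => // *; exact: open0.
move=> t U oU Ut.
have /(cm_nbhs dP)[e e0 eU] : nbhs t U by apply: open_nbhs_nbhs.
have [N Ne] := @exists_invS_lt R (e / 2) ltac:(lra).
have [c [tc Dc]] : [set y | d t y < N.+1%:R^-1] `&` D !=set0.
  apply: dD; last exact: cm_open_ball.
  by exists t; rewrite /= (cm_refl dP) invr_gt0 ltr0n.
exists (pickle (f c, N)); rewrite /B pickleK /=.
  by exists c => //; split=> //; rewrite (cm_sym dP).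
move=> y [c' Dc' [/fD]]; rewrite !inE => /(_ Dc' Dc) -> cy.
apply: eU => /=; move: (lt_trans cy Ne) (lt_trans tc Ne) (cm_triangle dP t c y).
by clear; lra.
Qed.

Lemma open_set_typeP (X : topologicalType) (A : set X) (U : set A) :
  open U <-> exists2 V : set X, open V & U = set_val @^-1` V.
Proof. by split=> [[V oV <-]|[V oV ->]]; exists V. Qed.

Lemma nbhs_set_type (X : topologicalType) (A : set X) (y : A) (N : set A) :
  nbhs y N <->
  exists V : set X, [/\ open V, V (set_val y) & set_val @^-1` V `<=` N].
Proof.
rewrite nbhsE; split=> [[U [/open_set_typeP[V oV ->] Vy] VN]|[V [oV Vy VN]]].
  by exists V.
by exists (set_val @^-1` V) => //; split=> //; apply/open_set_typeP; exists V.
Qed.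

Lemma set_type_ex (X : Type) (A : set X) (x : X) :
  A x -> exists y : A, set_val y = x.
Proof. by move=> Ax; exists (SigSub (mem_set Ax)). Qed.

Lemma Gdelta_baire (R : realType) (X : topologicalType) (A : set X) :
  polish R X -> Gdelta A -> baire_space A.
Proof.
move=> [_ [d dP]] [V oV AV] F FP O [y Oy] /open_set_typeP[W oW OW].
have /choice[H HP] n : exists H : set X, open H /\ F n = set_val @^-1` H.
  by have [/open_set_typeP[H oH FH] _] := FP n; exists H.
have AVn n z : A z -> V n z by rewrite AV => /(_ n I).
(* Intersecting each [H n] with [V n] forces the point found into [A]. *)
have [n|n C oC [z [Cz Az]]|||z [Wz Dz]] :=
    baire_relative dP (S := A) (D := fun n => V n `&` H n) (O := W).
- by apply: openI => //; exact: (HP n).1.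
- have [z' z'z] := set_type_ex Az.
  have [||w [/= Cw]] := (FP n).2 (set_val @^-1` C).
  + by exists z'; rewrite /= z'z.
  + by apply/open_set_typeP; exists C.
  rewrite (HP n).2 /= => Hw; have Aw := set_valP w.
  by exists (set_val w); split=> //; split=> //; split=> //; exact: AVn.
- by exact: oW.
- by exists (set_val y); split; [move: Oy; rewrite OW|exact: set_valP].
have Az : A z by rewrite AV => n _; exact: (Dz n).1.
have [z' z'z] := set_type_ex Az.
exists z'; split; first by rewrite OW /= z'z.
by move=> n _; rewrite (HP n).2 /= z'z; exact: (Dz n).2.
Qed.

Lemma baire_nonmeager (T : topologicalType) (t : T) :
  baire_space T -> nonmeager_in_itself T.
Proof.
move=> bT [F ndF TF].
have [|||z [_ Dz]] := bT (fun n => ~` closure (F n)) _ setT.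
- move=> n; split; first by apply: closed_openC; exact: closed_closure.
  move=> O [y Oy] oO; apply: contrapT => H.
  have : interior (closure (F n)) y.
    apply: filterS (open_nbhs_nbhs (conj oO Oy)) => w Ow.
    by apply: contrapT => nw; apply: H; exists w.
  by rewrite ndF.
- by exists t.
- exact: openT.
have : [set: T] z by [].
by rewrite TF => -[n _ Fz]; apply: (Dz n I); exact: subset_closure.
Qed.

(** * Open and almost open continuous images of complete spaces *)

Section ContinuousImages.
Context (R : realType) (T X : topologicalType) (d : T -> T -> R)
  (dX : X -> X -> R) (B : nat -> set T) (f : T -> X).
Hypotheses (dP : complete_metric d) (dXP : complete_metric dX).
Hypotheses (BP : sequential_basis B) (cf : continuous f).

Lemma basis_shrinks n i t : B i t -> exists2 j, B j t & shrinks d n (B j) (B i).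
Proof.
move=> Bt; have [C [oC Ct CS]] := exists_shrinks dP n (BP.1 i) Bt.
by have [j Bj jC] := BP.2 _ _ oC Ct; exists j => //; exact: CS.
Qed.

(** Successive choices in [Q] give shrinking sets [B (c n)] with a limit [l]. If [f l] differed from
    [z], continuity would put the image of some [B (c n)] within half their distance of [f l], so
    [z] would not be in its closure. *)
Lemma mem_image_of_closures (Q : nat -> Prop) (z : X) :
  (forall i, Q i -> closure (f @` B i) z) ->
  (forall i n, Q i -> exists2 j, shrinks d n (B j) (B i) & Q j) ->
  forall i, Q i -> (f @` B i) z.
Proof.
move=> Qcl Qsh i Qi.
have step (ni : nat * nat) : exists j,
    Q ni.2 -> shrinks d ni.1 (B j) (B ni.2) /\ Q j.
  case: ni => n k /=; have [Qk|nQ] := pselect (Q k); last by exists 0%N.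
  by have [j] := Qsh k n Qk; exists j.
have [next nextP] := choice step.
pose c := fix c n := if n is m.+1 then next (m, c m) else i.
have Qc n : Q (c n).
  by elim: n => [//|n IH]; have [] := nextP (n, c n) IH.
have [n|n|l [Cl lC]] := nested_limit dP (C := fun n => B (c n)).
- have [_ [[t Bt _] _]] := Qcl _ (Qc n) setT filterT.
  by exists t.
- exact: (nextP (n, c n) (Qc n)).1.
exists l; first exact: (Cl 0%N).
apply: contrapT => flz.
have e0 : 0 < dX (f l) z / 2 by rewrite divr_gt0// (cm_gt0 dXP).
have /lC[n nA] : nbhs l (f @^-1` [set y | dX (f l) y < dX (f l) z / 2]).
  by apply: cf; apply/(cm_nbhs dXP); exists (dX (f l) z / 2).
have [_ [[t /nA /= lt <-] /= zt]] :
    f @` B (c n) `&` [set y | dX z y < dX (f l) z / 2] !=set0.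
  by apply: Qcl (Qc n) _ _; apply/(cm_nbhs dXP); exists (dX (f l) z / 2).
by have := cm_triangle dXP (f l) (f t) z; rewrite (cm_sym dXP (f t) z); lra.
Qed.

Lemma open_image_Gdelta :
  (forall U, open U -> exists2 V, open V & f @` U = V `&` range f) ->
  Gdelta (range f).
Proof.
move=> of_.
have /choice[O OP] i : exists V, open V /\ f @` B i = V `&` range f.
  by have [V] := of_ _ (BP.1 i); exists V.
(* The implication in the description of the range, written as a closed set joined to an open
   one. *)
pose A i n := ~` O i `|` \bigcup_(j in [set j | shrinks d n (B j) (B i)]) O j.
have -> : range f =
    closure (range f) `&` (\bigcup_i O i) `&` \bigcap_i \bigcap_n A i n.
  apply/seteqP; split=> z.
    move=> [t _ <-].
    have fO i s : B i s -> O i (f s).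
      by move=> Bs; have : (f @` B i) (f s) by [exists s]; rewrite (OP i).2 => -[].
    split; first split.
    - by apply: subset_closure; exists t.
    - by have [i Bi _] := BP.2 t setT openT I; exists i => //; exact: fO.
    move=> i _ n _; have [Oi|nOi] := pselect (O i (f t)); last by left.
    have [s Bs fst] : (f @` B i) (f t) by rewrite (OP i).2; split=> //; exists t.
    have [j Bj jS] := basis_shrinks n Bs.
    by right; exists j => //; rewrite -fst; exact: fO.
  move=> [[clz [i _ Oi]] Az].
  have [||t _ tz] := @mem_image_of_closures (fun i => O i z) z _ _ i Oi; last by exists t.
  - move=> k Ok N Nz.
    have [w [wr [Nw Ow]]] := clz _ (filterI Nz (open_nbhs_nbhs (conj (OP k).1 Ok))).
    by exists w; split=> //; rewrite (OP k).2.
  - move=> k n Ok; have [/(_ Ok)//|[j jS Oj]] := Az k I n I.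
    by exists j.
apply: GdeltaI; first apply: GdeltaI.
- by apply: closed_Gdelta dXP _ _; exact: closed_closure.
- by apply: open_Gdelta; apply: bigcup_open => i _; exact: (OP i).1.
do 2!apply: Gdelta_bigcap => ?.
apply: closed_union_open_Gdelta dXP _ _ _ _.
  by apply: open_closedC; exact: (OP _).1.
by apply: bigcup_open => j _; exact: (OP j).1.
Qed.

(* The interior, relative to [range f], of the closure of [f @` U]: its trace
   on [range f] is an open set there, extended to an open set of [X]. *)
Definition relint (U : set T) : set X :=
  interior (~` range f `|` closure (f @` U)).

Definition almost_open : Prop :=
  forall (U : set T) t, open U -> U t -> relint U (f t).

Lemma open_relint U : open (relint U).
Proof. exact: open_interior. Qed.

Lemma relint_closure U t : relint U (f t) -> closure (f @` U) (f t).
Proof. by move=> /interior_subset[[]|//]; exists t. Qed.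

(** Otherwise each point of the range lies, for some [i], in the image of [B i] but outside
    [relint (B i)]. These countably many sets are nowhere dense. *)
Lemma nonmeager_almost_open_point : nonmeager_in_itself (range f) ->
  exists t, forall U : set T, open U -> U t -> relint U (f t).
Proof.
move=> nm; apply: contrapT => H; apply: nm.
exists (fun i => [set y : range f |
    (f @` B i) (set_val y) /\ ~ relint (B i) (set_val y)]).
  (* If the trace of an open [V] lies in the closure of such a set, then [V] lies in [relint (B i)];
     yet a nonempty trace meets the set. *)
  move=> i; rewrite /nowhere_dense -subset0 => y iy.
  have /nbhs_set_type[V [oV Vy Vcl]] := iy.
  have NV : nbhs y (set_val @^-1` V) by apply/nbhs_set_type; exists V; split.
  have [w [[_ nw] /= Vw]] := interior_subset iy _ NV; apply: nw.
  apply: filterS (open_nbhs_nbhs (conj oV Vw)) => v Vv.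
  have [rv|] := pselect (range f v); last by left.
  right=> N; rewrite nbhsE => -[N' [oN' N'v] N'N].
  have [v' v'v] := set_type_ex rv.
  have Vv' : (set_val @^-1` V) v' by rewrite /= v'v.
  have NN' : nbhs v' (set_val @^-1` N').
    by apply/nbhs_set_type; exists N'; split=> //; rewrite v'v.
  have [u [[fu _] N'u]] := Vcl _ Vv' _ NN'.
  by exists (set_val u); split=> //; exact: N'N.
apply/esym/seteqP; split=> // y _.
have [t _ fty] := set_valP y.
apply: contrapT => ny; apply: H; exists t => U oU Ut.
have [i Bi iU] := BP.2 _ _ oU Ut.
apply: contrapT => nr; apply: ny; exists i => //; split; first by exists t.
rewrite -[set_val y]fty; apply: contra_not nr.
by apply: interiorS; apply: setUS; apply: closureS; exact: image_subset.
Qed.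

(** Baire's theorem in [T] gives a point [s], with [f s] in both relative interiors, that lies in
    every [E k n]. Then [f s] belongs to the image of any [B k] with [f s] in [relint (B k)], in
    particular to both images. *)
Lemma almost_open_image_meet i j t : almost_open ->
  relint (B i) (f t) -> relint (B j) (f t) -> f @` B i `&` f @` B j !=set0.
Proof.
move=> ao it jt.
pose E (k n : nat) := f @^-1` (~` closure (f @` B k)) `|`
  \bigcup_(l in [set l | shrinks d n (B l) (B k)]) f @^-1` relint (B l).
have fO (O : set X) : open O -> open (f @^-1` O) by move: O; apply/continuousP.
have oE k n : open (E k n).
  apply: openU; first by apply: fO; apply: closed_openC; exact: closed_closure.
  by apply: bigcup_open => l _; apply: fO; exact: open_relint.
(* Near [f s], either the image of [B k] is absent and [s] itself works, or it has a point [f b].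
   Some [B l] around [b] shrinks in [B k], and the image of [A], dense near [f s], meets
   [relint (B l)]. *)
have dE k n (A : set T) s : open A -> A s -> A `&` E k n !=set0.
  move=> oA As; have := ao _ _ oA As; rewrite /relint /interior nbhsE => -[O [oO Os] OA].
  have [[_ [[b Bb <-] Ob]]|H] := pselect (f @` B k `&` O !=set0); last first.
    exists s; split=> //; left=> cl; apply: H; apply: cl.
    exact: open_nbhs_nbhs.
  have [l Bl lk] := basis_shrinks n Bb.
  have lb := ao _ _ (BP.1 l) Bl.
  have [[]|clb] := OA _ Ob; first by exists b.
  have [_ [[a Aa <-] [Oa la]]] : f @` A `&` (O `&` relint (B l)) !=set0.
    apply: clb; apply: open_nbhs_nbhs; split=> //.
    by apply: openI => //; exact: open_relint.
  by exists a; split=> //; right; exists l.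
have [n|n A oA [s [As _]]|||s [[is_ js] Ds]] := baire_relative dP (S := setT)
  (D := fun m => if unpickle m is Some kn then E kn.1 kn.2 else setT)
  (O := f @^-1` (relint (B i) `&` relint (B j))).
- by case: unpickle => [kn|]; [exact: oE|exact: openT].
- rewrite setIT; case: unpickle => [kn|]; first exact: dE As.
  by exists s.
- by apply: fO; apply: openI; exact: open_relint.
- by exists t.
have key k : relint (B k) (f s) -> (f @` B k) (f s).
  apply: (@mem_image_of_closures (fun k => relint (B k) (f s))).
    by move=> m; exact: relint_closure.
  move=> m n ms; have := Ds (pickle (m, n)); rewrite pickleK => -[/=|[l lm ls]].
    by move=> /(_ (relint_closure ms)).
  by exists l.
by exists (f s); split; apply: key.
Qed.

End ContinuousImages.

Lemma within_continuous_pair (A B C : topologicalType) (D : set (A * B))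
    (m : A * B -> C) (a : A) (b : B) (U : set C) :
  {within D, continuous m} -> D (a, b) -> open U -> U (m (a, b)) ->
  exists (N : set A) (M : set B), [/\ open_nbhs a N, open_nbhs b M &
    forall n k, N n -> M k -> D (n, k) -> U (m (n, k))].
Proof.
move=> /subspace_continuousP cm Dab oU Uab.
have [[P Q] /= [Pa Qb] PQ] := cm _ Dab _ (open_nbhs_nbhs (conj oU Uab)).
exists (interior P), (interior Q); split.
- by split=> //; exact: open_interior.
- by split=> //; exact: open_interior.
- move=> n k /interior_subset Pn /interior_subset Qk.
  exact: (PQ (n, k)).
Qed.

(** * Identities in a groupoid *)

Section GroupoidAlgebra.
Context (Ob Ar : Type) (G : groupoid Ob Ar).

Lemma inv_idt a : inv G (idt G a) = idt G a.
Proof.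
have := mul_idt G (inv G (idt G a)).
rewrite src_inv rng_idt => <-.
by rewrite inv_mul src_idt.
Qed.

Lemma mulKg g h : src G g = rng G h -> mul G (inv G g) (mul G g h) = h.
Proof.
move=> gh.
by rewrite mul_assoc ?src_inv// inv_mul gh idt_mul.
Qed.

Lemma invgK g : inv G (inv G g) = g.
Proof.
have gg : src G (inv G g) = rng G g by rewrite src_inv.
rewrite -[RHS](mulKg gg) inv_mul.
by rewrite -[X in idt G X](_ : src G (inv G (inv G g)) = _) ?mul_idt// src_inv rng_inv.
Qed.

Lemma mulgKV g h : src G g = src G h -> mul G (mul G g (inv G h)) h = g.
Proof.
move=> gh.
by rewrite -mul_assoc ?src_inv ?rng_inv// inv_mul -gh mul_idt.
Qed.

End GroupoidAlgebra.

(** * The orbit map of a Polish groupoid action *)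

Section PolishGroupoidOrbit.
Context (R : realType) (Ob Ar : topologicalType) (G : groupoid Ob Ar).
Context (X : topologicalType) (p : X -> Ob) (act : Ar -> X -> X).
Hypotheses (HG : polish_groupoid R G) (HX : polish_gspace R G p act).

Lemma idt_continuous : continuous (idt G).
Proof. by apply/continuousP => V oV; apply/(pg_idt HG); exists V. Qed.

Lemma src_open (U : set Ar) : open U -> open (src G @` U).
Proof.
move=> oU; apply/(pg_idt HG).
pose W := [set gh : Ar * Ar | U (inv G gh.1) /\ U gh.2].
have oW : open W.
  have oV : open (inv G @^-1` U).
    by have /continuousP/(_ _ oU) := pg_inv_continuous HG.
  rewrite openE => -[g h] [Ug Uh]; exists (inv G @^-1` U, U) => //.
  by split; exact: open_nbhs_nbhs.
exists [set mul G gh.1 gh.2 | gh in composable G `&` W].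
  exact: (pg_mul_open HG).
apply/seteqP; split=> b.
  move=> [g Ug <-]; exists (inv G g, g) => /=; last exact: inv_mul.
  split; first by rewrite /composable /= src_inv.
  by split=> //=; rewrite invgK.
move=> [[g h] /= [gh [_ /= Uh]] ghb]; exists h => //.
by rewrite -(src_mul gh) ghb src_idt.
Qed.

(** A nearby point [y] may have another anchor than [z], so [w] need not act on it; openness of the
    source map supplies an arrow of [W] close to [w] with source [p y]. *)
Lemma open_translate (W : set Ar) (A : set X) : open W -> open A ->
  open [set z | exists w, [/\ W w, src G w = p z & A (act w z)]].
Proof.
move=> oW oA; rewrite openE => z [w [Ww wz Awz]].
have [N [M [[oN Nw] [oM Mz] NM]]] :=
  within_continuous_pair (gs_act_continuous HX) (a := w) (b := z) wz oA Awz.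
have oS := src_open (openI oN oW).
have pz : nbhs z (p @^-1` (src G @` (N `&` W))).
  apply: (gs_anchor_continuous HX); apply: open_nbhs_nbhs; split=> //.
  by exists w.
apply: filterS (filterI (open_nbhs_nbhs (conj oM Mz)) pz).
move=> y [My [n [Nn Wn] ny]]; exists n; split=> //.
exact: NM.
Qed.

Context (x : X).

Definition orbit_map (t : [set g | src G g = p x]) : X := act (set_val t) x.

Lemma src_fiber (t : [set g | src G g = p x]) : src G (set_val t) = p x.
Proof. by have /= := set_valP t. Qed.

Lemma range_orbit_map : range orbit_map = groupoid_orbit G p act x.
Proof.
apply/seteqP; split=> y.
  by move=> [t _ <-]; exists (set_val t) => //; exact: src_fiber.
move=> [g gx <-]; have [t tg] := set_type_ex gx.
by exists t => //; rewrite /orbit_map tg.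
Qed.

Lemma anchor_orbit_map t : p (orbit_map t) = rng G (set_val t).
Proof. by rewrite /orbit_map (gs_anchor_act HX) ?src_fiber. Qed.

Lemma act_orbit_map g t : src G g = rng G (set_val t) ->
  exists s, set_val s = mul G g (set_val t) /\ orbit_map s = act g (orbit_map t).
Proof.
move=> gt.
have [|s sgt] := @set_type_ex _ [set g | src G g = p x] (mul G g (set_val t)).
  by rewrite /= src_mul// src_fiber.
by exists s; rewrite /orbit_map (gs_act_mul HX) ?src_fiber// sgt.
Qed.

Lemma orbit_map_continuous : continuous orbit_map.
Proof.
move=> t A; rewrite nbhsE => -[V [oV Vt] VA].
have [N [M [[oN Nt] [_ Mx] NM]]] := within_continuous_pair
  (gs_act_continuous HX) (a := set_val t) (b := x) (src_fiber t) oV Vt.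
apply/nbhs_set_type; exists N; split=> // s /= Ns; apply: VA.
by apply: NM => //=; exact: src_fiber.
Qed.

Lemma orbit_map_almost_open (B : nat -> set [set g | src G g = p x]) :
  sequential_basis B -> nonmeager_in_itself (range orbit_map) ->
  almost_open orbit_map.
Proof.
move=> BP /(nonmeager_almost_open_point BP)[t0 t0P] U t.
move=> /open_set_typeP[U0 oU0 ->] /= Ut.
(* The arrow [g] carries the good point [t0] to [t]. *)
pose g := mul G (set_val t) (inv G (set_val t0)).
have tt0 : src G (set_val t) = rng G (inv G (set_val t0)).
  by rewrite rng_inv !src_fiber.
have sg : src G g = rng G (set_val t0) by rewrite src_mul// src_inv.
have rg : rng G g = rng G (set_val t) by rewrite rng_mul.
have gt0 : mul G g (set_val t0) = set_val t by rewrite mulgKV// !src_fiber.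
have Ugt0 : U0 (mul G (g, set_val t0).1 (g, set_val t0).2) by rewrite /= gt0.
have [N [M [[oN Ng] [oM Mt0] NM]]] := within_continuous_pair
  (pg_mul_continuous HG) (a := g) (b := set_val t0) sg oU0 Ugt0.
have oM' : open (set_val @^-1` M : set [set g | src G g = p x]).
  by apply/open_set_typeP; exists M.
have rt0 := t0P _ oM' Mt0.
have oN' : open (inv G @^-1` N).
  by have /continuousP/(_ _ oN) := pg_inv_continuous HG.
have oA := open_translate oN' (open_relint orbit_map (set_val @^-1` M)).
apply: filterS (open_nbhs_nbhs (conj oA _)); last first.
  exists (inv G g); split.
  - by rewrite /= invgK.
  - by rewrite src_inv rg anchor_orbit_map.
  - rewrite /orbit_map (gs_act_mul HX) ?src_inv ?src_fiber//.
    by rewrite -gt0 mulKg.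
(* The arrow [v] moves [z] to a point in the closure of the image of [M]. Translating the
   neighborhood [A'] of [z] by [v] gives some [u] in [M] and [n] in [N] with [n u] in [U0] and its
   image in [A']. *)
move=> z [v [Nv vz rvz]].
have [[s _ sz]|] := pselect (range orbit_map z); last by left.
right=> A; rewrite nbhsE => -[A' [oA' A'z] A'A].
have vs : src G v = rng G (set_val s) by rewrite vz -sz anchor_orbit_map.
have [s' [_ s'E]] := act_orbit_map vs.
have /relint_closure cl : relint orbit_map (set_val @^-1` M) (orbit_map s').
  by rewrite s'E sz.
have [_ [[u Mu <-] [n [Nn nu A'nu]]]] :
    orbit_map @` (set_val @^-1` M) `&`
    [set y | exists n, [/\ N n, src G n = p y & A' (act n y)]] !=set0.
  apply: cl; apply: open_nbhs_nbhs; split; first exact: open_translate.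
  exists (inv G v); rewrite s'E sz; split=> //.
    by rewrite src_inv (gs_anchor_act HX).
  rewrite (gs_act_mul HX) ?src_inv// inv_mul vz.
  by rewrite (gs_act_idt HX).
rewrite anchor_orbit_map in nu.
have [w [wE wnu]] := act_orbit_map nu.
exists (orbit_map w); split; last by apply: A'A; rewrite wnu.
by exists w => //=; rewrite wE; exact: NM.
Qed.

Lemma orbit_map_open (d : [set g | src G g = p x] -> [set g | src G g = p x] -> R)
    (B : nat -> set [set g | src G g = p x]) :
  complete_metric d -> sequential_basis B -> almost_open orbit_map ->
  forall U, open U -> exists2 V, open V & orbit_map @` U = V `&` range orbit_map.
Proof.
move=> dP BP ao U oU.
have [_ [dX dXP]] := gs_polish HX.
suff H t : U t -> nbhs (orbit_map t) (~` range orbit_map `|` orbit_map @` U).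
  exists (interior (~` range orbit_map `|` orbit_map @` U)).
    exact: open_interior.
  apply/seteqP; split=> [_ [t Ut <-]|z [/interior_subset[]//]].
  by split; [exact: H|exists t].
move: oU => /open_set_typeP[U0 oU0 ->] /= Ut.
(* Since the unit [e] fixes [t], there are neighborhoods [N] of [e] and [M] of [t] whose products
   lie in [U0]. *)
pose e := idt G (rng G (set_val t)).
have et : src G e = rng G (set_val t) by rewrite src_idt.
have Uet : U0 (mul G (e, set_val t).1 (e, set_val t).2) by rewrite /= idt_mul.
have [N [M [[oN Ne] [oM Mt] NM]]] := within_continuous_pair
  (pg_mul_continuous HG) (a := e) (b := set_val t) et oU0 Uet.
have oM' : open (set_val @^-1` M : set [set g | src G g = p x]).
  by apply/open_set_typeP; exists M.
have [i Bit BiM] := BP.2 _ _ oM' Mt.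
have oN' : open (inv G @^-1` N).
  by have /continuousP/(_ _ oN) := pg_inv_continuous HG.
have pN : nbhs (orbit_map t) (p @^-1` (idt G @^-1` (inv G @^-1` N))).
  apply: (gs_anchor_continuous HX); apply: idt_continuous.
  apply: open_nbhs_nbhs; split=> //=.
  by rewrite anchor_orbit_map inv_idt.
have rN : nbhs (orbit_map t) (relint orbit_map (B i)).
  by apply: open_nbhs_nbhs; split; [exact: open_relint|exact: ao (BP.1 i) Bit].
apply: filterS (filterI rN pN) => z [riz Nz].
have [[s _ sz]|] := pselect (range orbit_map z); last by left.
rewrite -sz in riz Nz *.
(* These are the [k] with [s k^-1] in [N]. They include [s], since the unit at the anchor of [z]
   lies in [inv G @^-1] of [N]. *)
pose W := [set k : [set g | src G g = p x] |
  N (inv G (mul G (set_val k) (inv G (set_val s))))].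
have oW : open W.
  rewrite openE => k Wk.
  have ks : composable G (set_val k, inv G (set_val s)).
    by rewrite /composable /= rng_inv !src_fiber.
  have [K [K' [[oK Kk] [_ K's] KK']]] :=
    within_continuous_pair (pg_mul_continuous HG) ks oN' Wk.
  apply/nbhs_set_type; exists K; split=> // k' /= Kk'; apply: KK' => //.
  by rewrite /composable /= rng_inv !src_fiber.
have Ws : W s.
  by move: Nz; rewrite /W /= anchor_orbit_map mul_inv.
have [j Bjs BjW] := BP.2 _ _ oW Ws.
(* With [n = b s^-1], the equality of the images of [a] and [b] makes [n^-1 a] a preimage of [z]; it
   lies in [U0], as [n^-1] is in [N] and [a] in [M]. *)
have [_ [[a Bia <-] [b Bjb ba]]] := almost_open_image_meet dP dXP BP
  orbit_map_continuous ao riz (ao _ _ (BP.1 j) Bjs).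
pose n := mul G (set_val b) (inv G (set_val s)).
have bs : src G (set_val b) = rng G (inv G (set_val s)).
  by rewrite rng_inv !src_fiber.
have sn : src G n = rng G (set_val s) by rewrite src_mul// src_inv.
have rn : rng G n = rng G (set_val b) by rewrite rng_mul.
have nb : src G (inv G n) = rng G (set_val b) by rewrite src_inv.
have na : src G (inv G n) = rng G (set_val a).
  by rewrite nb -!anchor_orbit_map ba.
have [c [cE cna]] := act_orbit_map na.
right; exists c.
  by rewrite /= cE; apply: NM => //; [exact: BjW|exact: BiM].
rewrite cna -ba /orbit_map (gs_act_mul HX) ?src_fiber//.
have <- : mul G n (set_val s) = set_val b by rewrite mulgKV// !src_fiber.
by rewrite mulKg.
Qed.

Lemma nonmeager_orbit_Gdelta :
  nonmeager_in_itself (groupoid_orbit G p act x) ->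
  Gdelta (groupoid_orbit G p act x).
Proof.
rewrite -range_orbit_map => nm.
have [d [B [dP BP]]] := polish_basis (pg_src_fiber_polish HG (p x)).
have [_ [dX dXP]] := gs_polish HX.
apply: (open_image_Gdelta dP dXP BP orbit_map_continuous).
exact: orbit_map_open dP BP (orbit_map_almost_open BP nm).
Qed.

End PolishGroupoidOrbit.

Theorem theorem3p2 (R : realType) (Ob Ar : topologicalType)
    (G : groupoid Ob Ar) (HG : polish_groupoid R G)
    (X : topologicalType) (p : X -> Ob) (act : Ar -> X -> X)
    (HX : polish_gspace R G p act) (x : X) :
  (Gdelta (groupoid_orbit G p act x) <-> baire_space (groupoid_orbit G p act x)) /\
  (baire_space (groupoid_orbit G p act x) <->
     nonmeager_in_itself (groupoid_orbit G p act x)).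
Proof.
have G_B := Gdelta_baire (gs_polish HX) (A := groupoid_orbit G p act x).
have xO : groupoid_orbit G p act x x.
  by exists (idt G (p x)); [exact: src_idt|exact: (gs_act_idt HX)].
have [y _] := set_type_ex xO.
have B_N := @baire_nonmeager _ y.
have N_G := nonmeager_orbit_Gdelta HG HX (x := x).
by split; split=> //; [move=> /B_N|move=> /N_G].
Qed.
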